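(* The Kirch space $(\mathbb{N},\tau_K)$ is topologically rigid, i.e. the only homeomorphism $h:\mathbb{N}\to\mathbb{N}$ of the Kirch space onto itself is the identity map.
   Context: $\mathbb{N}=\{1,2,3,\dots\}$ and $\mathbb{N}_0=\{0\}\cup\mathbb{N}$. For $a,b\in\mathbb{N}$ let $a+b\mathbb{N}_0=\{a+bn:n\in\mathbb{N}_0\}$. A number $b$ is square-free if it is not divisible by the square of a prime. The Kirch topology $\tau_K$ on $\mathbb{N}$ is the topology generated by the base consisting of all arithmetic progressions $a+b\mathbb{N}_0$ where $a,b\in\mathbb{N}$ are coprime and $b$ is square-free (equivalently, generated by the subbase of all $a+p\mathbb{N}_0$ with $p$ prime and $a\in\mathbb{N}$ not divisible by $p$). The Kirch space is $(\mathbb{N},\tau_K)$. A topological space is topologically rigid if its homeomorphism group is trivial. *)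

(* Defs.v *)
From mathcomp Require Import all_boot.
Set Implicit Arguments. Unset Strict Implicit. Unset Printing Implicit Defensive.

Definition posnat := {n : nat | 0 < n}.

Definition prog (a b : nat) (x : nat) : Prop := exists k : nat, x = a + b * k.

Definition squarefree (b : nat) : Prop := forall p : nat, prime p -> ~ (p * p %| b).

(* Basic open sets of the Kirch topology: a + b N_0 with a, b in N,
   gcd(a,b) = 1 and b square-free. *)
Definition kirch_basic (a b : nat) : Prop :=
  0 < a /\ 0 < b /\ coprime a b /\ squarefree b.

Definition kirch_open (U : posnat -> Prop) : Prop :=
  forall x : posnat, U x ->
    exists a b : nat, kirch_basic a b /\ prog a b (sval x) /\
      (forall y : posnat, prog a b (sval y) -> U y).

Definition kirch_continuous (f : posnat -> posnat) : Prop :=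
  forall U : posnat -> Prop, kirch_open U -> kirch_open (fun x => U (f x)).

Definition kirch_homeomorphism (h : posnat -> posnat) : Prop :=
  exists g : posnat -> posnat,
    (forall x, g (h x) = x) /\ (forall y, h (g y) = y) /\
    kirch_continuous h /\ kirch_continuous g.

(* Main.v *)
(** If p does not divide x, the closure of x + pN_0 is {y : y = 0 or x mod p}.
    Hence, for a finite set E, the intersections of closures of neighbourhoods of
    the points of E get inside the closure of every nonempty open set unless, for
    some odd prime p and some r <> 0 mod p, E lies in the set H(p,r) of points
    congruent to 0 or r mod p ([zero_or p r]); call E aligned in that case.  Alignment is thus a
    topological invariant.

    A pair {x, y} is not aligned iff xy(x - y) is, up to sign, a power of 2, that
    is, iff x and y are consecutive powers of 2; so a homeomorphism h induces an
    automorphism of the path 1 - 2 - 4 - 8 - ... and fixes every power of 2.  The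
    maximal sets all of whose finite subsets are aligned are the H(p,r), so h
    permutes them, and it preserves p because a finite cover of N by sets H(q,s)
    contains all q - 1 of them for some q.  Since h fixes 2^n, it preserves the
    congruence x = 2^n mod p, so every odd prime dividing x - 2^n divides
    x - h(x).  As n varies, infinitely many primes divide x - 2^n, and h(x) = x. *)

Require Import Defs.
From mathcomp Require Import all_boot cyclic zify.
From Stdlib Require Import Classical IndefiniteDescription.
Set Implicit Arguments. Unset Strict Implicit. Unset Printing Implicit Defensive.

(** * Products of primes and Chinese remaindering *)

Lemma squarefree_dvd b n :
  0 < b -> squarefree b -> (forall p, prime p -> p %| b -> p %| n) -> b %| n.
Proof.
move=> b0 sb Hn; apply/dvdn_partP => // p.
rewrite mem_primes => /and3P[pp _ pb]; rewrite p_part.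
suff : logn p b <= 1.
  by case: (logn p b) => [|[|]] //= _; rewrite ?dvd1n ?expn1 ?Hn.
rewrite leqNgt; apply/negP => l2; apply: (sb p pp).
by rewrite mulnn pfactor_dvdn.
Qed.

Lemma prime_dvd_prod p (L : seq nat) :
  prime p -> all prime L -> p %| \prod_(q <- L) q -> p \in L.
Proof.
move=> pp; elim: L => [|q L IH] /=.
  by rewrite big_nil dvdn1 => _ /eqP p1; rewrite p1 in pp.
move=> /andP[pq pL]; rewrite big_cons Euclid_dvdM // in_cons.
move=> /orP[|/(IH pL)->]; last by rewrite orbT.
by rewrite dvdn_prime2 // => ->.
Qed.

Lemma squarefree_prod (L : seq nat) :
  uniq L -> all prime L -> squarefree (\prod_(q <- L) q).
Proof.
elim: L => [|q L IH] /=.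
  rewrite big_nil => _ _ p pp; rewrite dvdn1 muln_eq1 => /andP[/eqP p1 _].
  by rewrite p1 in pp.
move=> /andP[qL uL] /andP[pq pL] p pp; rewrite big_cons.
have [epq|npq] := eqVneq p q.
  rewrite epq dvdn_pmul2l ?prime_gt0 // => /(prime_dvd_prod pq pL) pL'.
  by rewrite pL' in qL.
rewrite Gauss_dvdr; first exact: IH.
by rewrite coprimeMl prime_coprime // dvdn_prime2 // npq.
Qed.

Lemma prod_prime_gt0 (L : seq nat) : all prime L -> 0 < \prod_(q <- L) q.
Proof.
elim: L => [|q L IH] /=; first by rewrite big_nil.
by move=> /andP[/prime_gt0 q0 /IH L0]; rewrite big_cons muln_gt0 q0.
Qed.

Lemma dvdn_prod_mem (L : seq nat) p : p \in L -> p %| \prod_(q <- L) q.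
Proof.
elim: L => //= q L IH; rewrite in_cons big_cons => /orP[/eqP->|/IH d].
  exact: dvdn_mulr.
exact: dvdn_mull.
Qed.

Lemma coprime_prod_primes a (L : seq nat) :
  all prime L -> (forall p, p \in L -> ~~ (p %| a)) -> coprime a (\prod_(q <- L) q).
Proof.
elim: L => [|q L IH] /=; first by rewrite big_nil coprimen1.
move=> /andP[pq pL] H; rewrite big_cons coprimeMr coprime_sym prime_coprime //.
rewrite H ?mem_head //= IH // => p pl; apply: H; by rewrite in_cons pl orbT.
Qed.

Lemma crt_primes (L : seq nat) (s : nat -> nat) :
  all prime L -> exists2 y, 0 < y & forall q, q \in L -> y = s q %[mod q].
Proof.
move=> pL; wlog uL : L pL / uniq L.
  move=> W; have [||y y0 Hy] := W (undup L); rewrite ?undup_uniq //.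
    by rewrite (eq_all_r (mem_undup L)).
  by exists y => // q qL; apply: Hy; rewrite mem_undup.
elim: L pL uL => [|q L IH] /=; first by exists 1.
move=> /andP[pq pL] /andP[qL uL]; have [y y0 Hy] := IH pL uL.
set P := \prod_(p <- L) p.
have P0 : 0 < P by exact: prod_prime_gt0.
have cop : coprime q P.
  apply: coprime_prod_primes => // p pl; apply/negP.
  have pp : prime p by exact: (allP pL).
  by rewrite dvdn_prime2 // => /eqP e; rewrite -e pl in qL.
(* The summand [q * P] makes the solution positive and changes no residue. *)
exists (chinese q P (s q) y + q * P).
  by rewrite (ltn_addl _ (n := q * P)) // muln_gt0 prime_gt0 // P0.
move=> p; rewrite in_cons => /orP[/eqP->|pl].
  by rewrite [q * P]mulnC addnC modnMDl chinese_modl.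
have pP : p %| P by exact: dvdn_prod_mem.
rewrite -Hy // -[LHS](modn_dvdm _ pP) addnC modnMDl chinese_modr //.
exact: modn_dvdm.
Qed.

(** * Congruence neighbourhoods and their closures *)

Definition avoids (L : seq nat) (x : nat) : Prop :=
  all prime L /\ forall p, p \in L -> ~~ (p %| x).

Definition cong (L : seq nat) (x : nat) (y : posnat) : Prop :=
  forall p, p \in L -> sval y = x %[mod p].

(* The lower bound in a progression [a + b N_0] is absorbed by adjoining to [L]
   a prime exceeding [x]. *)
Lemma kirch_openP (U : posnat -> Prop) :
  kirch_open U <-> forall x, U x ->
    exists2 L, avoids L (sval x) & forall y, cong L (sval x) y -> U y.
Proof.
split=> oU x /(oU x); last first.
  move=> [L [pL aL] HL]; exists (sval x), (\prod_(q <- undup L) q).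
  have pL' : all prime (undup L) by rewrite (eq_all_r (mem_undup L)).
  split; first split; first exact: (svalP x).
    split; first exact: prod_prime_gt0.
    split; last by apply: squarefree_prod; rewrite ?undup_uniq.
    by apply: coprime_prod_primes => // p; rewrite mem_undup; apply: aL.
  split; first by exists 0; rewrite muln0 addn0.
  move=> y [k yk]; apply: HL => p pL1; rewrite yk.
  have /dvdnP[c ->] : p %| \prod_(q <- undup L) q.
    by apply: dvdn_prod_mem; rewrite mem_undup.
  by rewrite mulnAC addnC modnMDl.
move=> [a [b [[a0 [b0 [cab sb]]] [[k xk] HU]]]].
have [P xP pP] := prime_above (sval x).
exists (P :: primes b).
  split=> /=; first by rewrite pP; apply/allP => p; rewrite mem_primes => /andP[].
  move=> p; rewrite in_cons => /orP[/eqP->|].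
    by rewrite gtnNdvd //; exact: (svalP x).
  rewrite mem_primes => /and3P[pp _ pb]; apply/negP => px.
  have pa : p %| a by move: px; rewrite xk dvdn_addl // dvdn_mulr.
  have : p %| gcdn a b by rewrite dvdn_gcd pa.
  by rewrite (eqP cab) dvdn1 => /eqP p1; rewrite p1 in pp.
move=> y Hy; apply: HU.
have xy : sval x <= sval y.
  have := Hy P (mem_head _ _); rewrite [sval x %% P]modn_small // => <-.
  exact: leq_mod.
have : b %| sval y - sval x.
  apply: squarefree_dvd => // p pp pb; rewrite -eqn_mod_dvd //.
  by apply/eqP; apply: Hy; rewrite in_cons mem_primes pp b0 pb orbT.
move=> /dvdnP[c yx]; exists (k + c); nia.
Qed.

Definition kcl (U : posnat -> Prop) (z : posnat) : Prop :=
  forall V, kirch_open V -> V z -> exists2 w, V w & U w.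

Lemma cong_open L x : all prime L -> (forall p, p \in L -> ~~ (p %| x)) ->
  kirch_open (cong L x).
Proof.
move=> pL aL; apply/kirch_openP => y Hy; exists L.
  split=> // p pl; move: (aL p pl); rewrite /dvdn.
  by rewrite (Hy p pl).
by move=> z Hz p pl; rewrite Hz // Hy.
Qed.

(** A neighbourhood of [z] constrains only primes not dividing [z]; at those in [L] the hypothesis
    makes [z] and [x] congruent, so Chinese remaindering gives a common point. *)
Lemma kcl_cong L x z : avoids L x ->
  (forall p, p \in L -> (p %| sval z) \/ sval z = x %[mod p]) ->
  kcl (cong L x) z.
Proof.
move=> [pL aL] H V /kirch_openP oV /oV[L' [pL' aL'] HV].
have [|w w0 Hw] := @crt_primes (L ++ L') (fun p => if p \in L' then sval z else x).
  by rewrite all_cat pL.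
exists (exist _ w w0).
  by apply: HV => p pl /=; rewrite Hw ?mem_cat ?pl ?orbT.
move=> p pl /=; rewrite Hw ?mem_cat ?pl //.
case: ifP => // pl'; case: (H p pl) => // pz.
by move: (aL' p pl'); rewrite pz.
Qed.

Lemma kclS (U V : posnat -> Prop) z : (forall y, U y -> V y) -> kcl U z -> kcl V z.
Proof. by move=> UV c W oW Wz; have [w Ww Uw] := c W oW Wz; exists w; auto. Qed.

(** If [p] does not divide [z], the class of [z] modulo [p] is a neighbourhood of [z] and must meet
    [cong L x]. *)
Lemma kcl_congW L x z p : kcl (cong L x) z -> prime p -> p \in L ->
  (p %| sval z) \/ sval z = x %[mod p].
Proof.
move=> c pp pl; case: (boolP (p %| sval z)) => [|npz]; [by left|right].
have [||w Hw Hx] := c (cong [:: p] (sval z)).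
- by apply: cong_open => [|q]; rewrite /= ?pp // inE => /eqP->.
- by move=> q.
by rewrite -Hw ?mem_head // Hx.
Qed.

(** * Alignment as a topological invariant *)

(** Phrased by open sets and closures alone, so that homeomorphisms preserve it; it turns out to be
    the negation of alignment. *)
Definition caps_small (E : seq posnat) : Prop :=
  forall W, kirch_open W -> (exists w, W w) ->
  exists U : posnat -> posnat -> Prop,
    (forall x, kirch_open (U x) /\ U x x) /\
    (forall z, (forall x, x \in E -> kcl (U x) z) -> kcl W z).

Definition zero_or (p r : nat) (x : posnat) : bool :=
  (p %| sval x) || (sval x == r %[mod p]).

(* [2 < p] excludes [p = 2], for which [zero_or 2 1] holds everywhere. *)
Definition odd_residue (p r : nat) : Prop := [/\ prime p, 2 < p & 0 < r < p].

Definition aligned (E : seq posnat) : Prop :=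
  exists p r, odd_residue p r /\ all (zero_or p r) E.

(* Off the prime 2, where the classes 0 and 1 already exhaust [N], the closures
   of the neighbourhoods of points of [E] force each prime of [W] to divide [z]. *)
Lemma not_aligned_caps_small E : ~ aligned E -> caps_small E.
Proof.
move=> nE W /kirch_openP oW [w /oW[L [pL aL] LW]].
(* Only the primes of [W] not dividing [x] define a neighbourhood of [x]. *)
pose f (x : posnat) := filter (fun p => ~~ (p %| sval x)) L.
exists (fun x => cong (f x) (sval x)); split.
  move=> x; split=> //; apply: cong_open => [|p].
    by rewrite all_filter; apply: sub_all pL => p /= ->; rewrite implybT.
  by rewrite mem_filter => /andP[].
move=> z Hz; apply: (kclS LW); apply: kcl_cong => // p pl.
have pp := allP pL p pl.
have [p2|p2] := leqP p 2.
  have {}p2 : p = 2 by move: (prime_gt1 pp); lia.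
  by move: (aL p pl); rewrite p2 !modn2 !dvdn2; case: (odd (sval w)) => // _;
    case: odd; auto.
left; apply/negPn/negP => npz; apply: nE.
have Kz x : x \in E -> (p %| sval x) || (sval z == sval x %[mod p]).
  move=> xE; case: (boolP (p %| sval x)) => //= npx.
  case: (kcl_congW (Hz x xE) pp); first by rewrite mem_filter npx.
    by move=> pz; rewrite pz in npz.
  by move=> ->.
exists p, (sval z %% p); split.
  by split=> //; rewrite lt0n ltn_pmod ?prime_gt0 // andbT.
by apply/allP => x /Kz; rewrite /zero_or modn_mod eq_sym.
Qed.

(** Take for [W] a class [t] modulo [p] other than 0 and [r]. A point congruent to [r] modulo [p]
    and to 0 modulo the other primes of the chosen neighbourhoods lies in all their closures, but
    not in that of [W]. *)
Lemma aligned_not_caps_small E : aligned E -> ~ caps_small E.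
Proof.
move=> [p [r [[pp p2 /andP[r0 rp]] /allP HE]]] cE.
pose t := if r == 1 then 2 else 1.
have t0 : 0 < t by rewrite /t; case: ifP.
have tp : t < p by rewrite /t; case: ifP => _ //; lia.
have tr : t != r by rewrite /t; case: ifP => [/eqP-> //|/negbT]; rewrite eq_sym.
have modt : t %% p = t by rewrite modn_small.
have modr : r %% p = r by rewrite modn_small.
have dvp s : 0 < s < p -> ~~ (p %| s).
  by move=> /andP[s0 sp]; rewrite gtnNdvd.
have [||U [oU HU]] := cE (cong [:: p] t).
- by apply: cong_open => [|q]; rewrite /= ?pp // inE => /eqP->; apply: dvp; rewrite t0.
- by exists (exist _ t t0) => q.
have [M HM] : exists M : seq nat, all prime M /\ forall x, x \in E ->
    exists L, [/\ {subset L <= M}, avoids L (sval x)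
                & forall y, cong L (sval x) y -> U x y].
  elim: (E) => [|x E' [M [pM IH]]]; first by exists [::].
  have [/kirch_openP oUx Ux] := oU x.
  have [L aL LU] := oUx x Ux; exists (L ++ M); split.
    by rewrite all_cat pM (proj1 aL).
  move=> y; rewrite in_cons => /orP[/eqP->|/IH[L' [s aL' LU']]].
    by exists L; split=> // q ql; rewrite mem_cat ql.
  by exists L'; split=> // q /s ql; rewrite mem_cat ql orbT.
case: HM => pM HM.
have [|z z0 Hz] := @crt_primes (p :: M) (fun q => if q == p then r else 0).
  by rewrite /= pp.
have zp : z = r %[mod p] by rewrite Hz ?mem_head // eqxx.
have npz : ~~ (p %| z) by rewrite /dvdn zp modr -lt0n.
have : kcl (cong [:: p] t) (exist _ z z0).
  apply: HU => x xE; have [L [LM aL LU]] := HM x xE.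
  apply: (kclS LU); apply: kcl_cong => // q ql /=.
  have [eqp|nqp] := eqVneq q p.
    right; rewrite eqp zp; have := HE x xE; rewrite /zero_or.
    have := proj2 aL q ql; rewrite eqp => /negPf-> /= /eqP->.
    by [].
  left; rewrite /dvdn Hz; last by rewrite in_cons LM ?orbT.
  by rewrite (negPf nqp) mod0n.
move=> /kcl_congW-/(_ p pp (mem_head _ _))[] /=.
  by apply/negP.
by rewrite zp modt modr => /esym/eqP; apply/negP.
Qed.

Lemma caps_small_map h g E : cancel h g -> cancel g h ->
  kirch_continuous h -> kirch_continuous g -> caps_small E -> caps_small (map h E).
Proof.
move=> hK gK ch cg cE W oW [w Ww].
have [|U [oU HU]] := cE (fun x => W (h x)) (ch W oW).
  by exists (g w); rewrite gK.
exists (fun y x => U (g y) (g x)); split.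
  by move=> y; have [o u] := oU (g y); split=> //; apply: (cg (U (g y))).
move=> z Hz; have Wz : kcl (fun x => W (h x)) (g z).
  apply: HU => x xE V oV Vz.
  have [w' Vw' Uw'] := Hz (h x) (map_f h xE) _ (cg V oV) Vz.
  by exists (g w') => //; rewrite hK in Uw'.
move=> V oV Vz; have [|w' Vw' Ww'] := Wz _ (ch V oV); first by rewrite gK.
by exists (h w').
Qed.

Lemma aligned_map h g E : cancel h g -> cancel g h ->
  kirch_continuous h -> kirch_continuous g -> aligned E -> aligned (map h E).
Proof.
move=> hK gK ch cg aE; apply: NNPP => /not_aligned_caps_small /(caps_small_map gK hK cg ch).
by rewrite (mapK hK); apply: aligned_not_caps_small.
Qed.

Definition homeo (h g : posnat -> posnat) : Prop :=
  [/\ cancel h g, cancel g h, kirch_continuous h & kirch_continuous g].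

Lemma homeo_sym h g : homeo h g -> homeo g h.
Proof. by case. Qed.

Lemma homeo_aligned h g E : homeo h g -> aligned E -> aligned (map h E).
Proof. by case; apply: aligned_map. Qed.

(** * Non-aligned pairs and the path of powers of 2 *)

Definition pow2 (n : nat) : posnat := exist _ (2 ^ n) (expn_gt0 2 n).

Lemma pow2_inj : injective pow2.
Proof. by move=> i j /(congr1 sval) /= /eqP; rewrite eqn_exp2l // => /eqP. Qed.

Lemma pow2P n : 0 < n -> (forall p, prime p -> 2 < p -> ~~ (p %| n)) ->
  exists k, n = 2 ^ k.
Proof.
move=> n0 Hn; suff /p_natP[k ->] : 2.-nat n by exists k.
apply/pnatP => // p pp pn; rewrite inE /=; have := prime_gt1 pp.
by rewrite leq_eqVlt eq_sym => /orP[//|/(Hn p pp)]; rewrite pn.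
Qed.

Lemma odd_prime_ndvd_pow2 p n : prime p -> 2 < p -> ~~ (p %| 2 ^ n).
Proof.
move=> pp p2; rewrite Euclid_dvdX // negb_and dvdn_prime2 //.
by rewrite gtn_eqF.
Qed.

(** If [j - i] is at least 2, then [2 ^ (j - i) - 1] is odd and exceeds 1, so it has an odd prime
    factor. *)
Lemma pow2_not_cong i j : i < j ->
  (forall p, prime p -> 2 < p -> 2 ^ i <> 2 ^ j %[mod p]) -> j = i.+1.
Proof.
move=> ij Hp; apply/eqP; rewrite eq_sym eqn_leq ij /= leqNgt; apply/negP => ij2.
have [k [k1 ej]] : exists k, 1 < k /\ j = i + k by exists (j - i); lia.
subst j.
have k4 : 2 ^ 2 <= 2 ^ k by rewrite leq_exp2l.
have [|p pp pd] := @pdivP (2 ^ k - 1); first by lia.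
have p2 : 2 < p.
  have := prime_gt1 pp; rewrite leq_eqVlt => /orP[/eqP e|//]; move: pd.
  by rewrite -e dvdn2 oddB ?expn_gt0 // oddX; case: (k) k1.
apply: (Hp p pp p2); apply/esym/eqP; rewrite eqn_mod_dvd ?leq_exp2l ?leq_addr //.
by rewrite expnD -{2}[2 ^ i]muln1 -mulnBr dvdn_mull.
Qed.

Lemma aligned_pair (x y : posnat) p : prime p -> 2 < p ->
  [\/ p %| sval x, p %| sval y | sval x = sval y %[mod p]] -> aligned [:: x; y].
Proof.
move=> pp p2 D.
have vmod (z : posnat) : ~~ (p %| sval z) -> odd_residue p (sval z %% p).
  by move=> nz; split; rewrite // lt0n nz ltn_pmod // prime_gt0.
have [px|npx] := boolP (p %| sval x).
  have [py|npy] := boolP (p %| sval y).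
    exists p, 1; split; last by rewrite /= /zero_or px py.
    by split=> //=; exact: ltnW.
  exists p, (sval y %% p); split; first exact: vmod.
  by rewrite /= /zero_or px modn_mod eqxx orbT.
exists p, (sval x %% p); split; first exact: vmod.
rewrite /= /zero_or !modn_mod eqxx orbT andbT /=.
case: D => [px|->//|->]; last by rewrite eqxx orbT.
by rewrite px in npx.
Qed.

Lemma not_aligned_pairP x y : ~ aligned [:: x; y] <->
  exists n, (x = pow2 n /\ y = pow2 n.+1) \/ (x = pow2 n.+1 /\ y = pow2 n).
Proof.
split=> [na|].
  have nx p : prime p -> 2 < p -> ~~ (p %| sval x).
    by move=> pp p2; apply/negP => px; apply: na; apply: (aligned_pair pp p2); constructor 1.
  have ny p : prime p -> 2 < p -> ~~ (p %| sval y).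
    by move=> pp p2; apply/negP => py; apply: na; apply: (aligned_pair pp p2); constructor 2.
  have nxy p : prime p -> 2 < p -> sval x <> sval y %[mod p].
    by move=> pp p2 xy; apply: na; apply: (aligned_pair pp p2); constructor 3.
  have [i xi] := pow2P (svalP x) nx; have [j yj] := pow2P (svalP y) ny.
  have ex : x = pow2 i by apply: val_inj.
  have ey : y = pow2 j by apply: val_inj.
  rewrite xi yj in nxy; case: (ltngtP i j) => [ij|ji|eij].
  - by exists i; left; rewrite ex ey (pow2_not_cong ij nxy).
  - exists j; right; rewrite ex ey (pow2_not_cong ji) // => p pp p2 /esym.
    exact: nxy.
  - by case: (@nxy 3); rewrite ?eij.
have key n : aligned [:: pow2 n; pow2 n.+1] -> False.
  move=> [p [r [[pp p2 _]]]]; rewrite /= /zero_or !(negPf (odd_prime_ndvd_pow2 _ pp p2)) /=.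
  rewrite andbT => /andP[/eqP <-]; rewrite eqn_mod_dvd ?leq_exp2l //.
  by rewrite expnS mul2n -addnn addnK (negPf (odd_prime_ndvd_pow2 _ pp p2)).
move=> [n [[-> ->]|[-> ->]]]; first exact: key.
move=> [p [r [v]]]; rewrite /= andbT andbC => a; apply: (key n); exists p, r.
by rewrite /= andbT.
Qed.

Lemma homeo_pow2 h g n : homeo h g -> h (pow2 n) = pow2 n.
Proof.
move=> hg; have [hK gK _ _] := hg.
have adjh x y : ~ aligned [:: x; y] -> ~ aligned [:: h x; h y].
  by move=> na /(homeo_aligned (homeo_sym hg)) /=; rewrite !hK.
have adjg x y : ~ aligned [:: x; y] -> ~ aligned [:: g x; g y].
  by move=> na /(homeo_aligned hg) /=; rewrite !gK.
have path m : ~ aligned [:: pow2 m; pow2 m.+1].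
  by apply/not_aligned_pairP; exists m; left.
have path' m : ~ aligned [:: pow2 m.+1; pow2 m].
  by apply/not_aligned_pairP; exists m; right.
have end0 y : ~ aligned [:: pow2 0; y] -> y = pow2 1.
  move=> /not_aligned_pairP[m [[/pow2_inj <- ->]|[/pow2_inj e _]]] //.
have h0 : h (pow2 0) = pow2 0.
  have [m hm] : exists m, h (pow2 0) = pow2 m.
    by have /adjh/not_aligned_pairP[m [[-> _]|[-> _]]] := path 0; eexists.
  have gm : g (pow2 m) = pow2 0 by rewrite -hm hK.
  (* At an inner vertex, [g] would send both neighbours to the only neighbour of 1, against
     injectivity. *)
  case: m hm gm => // m hm gm.
  have /adjg := path' m; rewrite gm => /end0 e1.
  have /adjg := path m.+1; rewrite gm => /end0 e2.
  by move: (congr1 h (etrans e1 (esym e2))); rewrite !gK => /pow2_inj; lia.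
have h1 : h (pow2 1) = pow2 1.
  by have /adjh := path 0; rewrite h0 => /end0.
(* Once two consecutive powers are fixed, injectivity keeps the path from turning back. *)
suff [] : h (pow2 n) = pow2 n /\ h (pow2 n.+1) = pow2 n.+1 by [].
elim: n => [|n [IH1 IH2]] //; split=> //.
have /adjh := path n.+1; rewrite IH2.
move=> /not_aligned_pairP[m [[/pow2_inj<- //]|[/pow2_inj[<-]]]].
by rewrite -IH1 => /(can_inj hK)/pow2_inj; lia.
Qed.

(** * The sets H(p,r) and their images *)

(** The modulus [p] divides one of [x], [y] or their nonzero difference. *)
Lemma zero_or_pair_leq p r (x y : posnat) :
  odd_residue p r -> x <> y -> zero_or p r x -> zero_or p r y ->
  p <= sval x + sval y.
Proof.
move=> [_ _ /andP[_ rp]] nxy Hx Hy.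
have x0 := svalP x; have y0 := svalP y.
case/orP: Hx => [/(dvdn_leq x0)|/eqP xr]; first by lia.
case/orP: Hy => [/(dvdn_leq y0)|/eqP yr]; first by lia.
have nv : sval x <> sval y by move=> /val_inj.
case: (ltngtP (sval x) (sval y)) => // xy.
  have : p %| sval y - sval x by rewrite -(eqn_mod_dvd p (ltnW xy)) xr yr.
  by move=> /dvdn_leq; lia.
have : p %| sval x - sval y by rewrite -(eqn_mod_dvd p (ltnW xy)) xr yr.
by move=> /dvdn_leq; lia.
Qed.

(* Two distinct points of [A] leave only finitely many candidates [(p, r)], so
   if all failed then finitely many witnesses would form a non-aligned set. *)
Lemma aligned_family (A : posnat -> Prop) x y : x <> y -> A x -> A y ->
  (forall E : seq posnat, (forall z, z \in E -> A z) -> aligned E) ->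
  exists p r, odd_residue p r /\ forall z, A z -> zero_or p r z.
Proof.
move=> nxy Ax Ay HA; apply: NNPP => nex.
have /functional_choice[f Hf] (c : nat * nat) :
    exists z, A z /\ (odd_residue c.1 c.2 -> ~~ zero_or c.1 c.2 z).
  case: (classic (odd_residue c.1 c.2)) => v; last by exists x.
  apply: NNPP => nz; apply: nex; exists c.1, c.2; split=> // z Az.
  by apply/negPn/negP => nH; apply: nz; exists z.
pose N := (sval x + sval y).+1.
pose C := [seq (p, r) | p <- iota 0 N, r <- iota 0 N].
have [|p [r [v]]] := HA [:: x, y & map f C].
  move=> z; rewrite 2!in_cons => /or3P[/eqP->|/eqP->|/mapP[c _ ->]] //.
  by have [] := Hf c.
move=> /allP HE; have [pp p2 /andP[r0 rp]] := v.
have Hx : zero_or p r x by apply: HE; rewrite mem_head.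
have Hy : zero_or p r y by apply: HE; rewrite in_cons mem_head orbT.
have pN : p < N by exact: (zero_or_pair_leq v nxy).
have : (p, r) \in C.
  by apply/allpairsP; exists (p, r); rewrite !mem_iota /= pN (ltn_trans rp pN).
move=> /(map_f f) fC; move: (proj2 (Hf (p, r)) v); apply/negP/negPn.
by apply: HE; rewrite 2!in_cons fC !orbT.
Qed.

Lemma aligned_sub p r E :
  odd_residue p r -> (forall z, z \in E -> zero_or p r z) -> aligned E.
Proof. by move=> v HE; exists p, r; split=> //; apply/allP. Qed.

Lemma homeo_zero_or_sub h g p r : homeo h g -> odd_residue p r ->
  exists q s, odd_residue q s /\ forall x, zero_or p r x -> zero_or q s (h x).
Proof.
move=> hg v; have [hK gK _ _] := hg; have [pp p2 /andP[r0 rp]] := v.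
(* The points [r < p] of H(p,r) supply the two distinct points whose images bound the candidates. *)
pose x : posnat := exist _ r r0; pose y : posnat := exist _ p (prime_gt0 pp).
have [||||q [s [vq Hq]]] := @aligned_family (fun z => zero_or p r (g z)) (h x) (h y).
- by move=> /(can_inj hK) /(congr1 sval) /= e; rewrite e ltnn in rp.
- by rewrite hK /zero_or eqxx orbT.
- by rewrite hK /zero_or dvdnn.
- move=> E HE; rewrite -(mapK gK E); apply: (homeo_aligned hg).
  by apply: (aligned_sub v) => z /mapP[w wE ->]; apply: HE.
by exists q, s; split=> // z Hz; apply: Hq; rewrite hK.
Qed.

(** For distinct primes, some point is [r] modulo [p] but neither 0 nor [s] modulo [q]; for equal
    primes, the point [r] decides. *)
Lemma zero_or_sub_inj p r q s : odd_residue p r -> odd_residue q s ->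
  (forall x, zero_or p r x -> zero_or q s x) -> p = q /\ r = s.
Proof.
move=> [pp p2 /andP[r0 rp]] [pq q2 /andP[s0 sq]] sub.
have dvp t d : 0 < t -> t < d -> d %| t = false by move=> *; rewrite gtnNdvd.
have epq : p = q.
  apply/eqP/negPn/negP => npq; pose t := if s == 1 then 2 else 1.
  have [t0 tq ts] : [/\ 0 < t, t < q & t != s].
    rewrite /t; case: ifP => [/eqP->|/negbT] //; rewrite eq_sym; split=> //; lia.
  have [|z z0 Hz] := @crt_primes [:: p; q] (fun d => if d == p then r else t).
    by rewrite /= pp pq.
  have zp : z = r %[mod p] by rewrite Hz ?mem_head // eqxx.
  have zq : z = t %[mod q].
    by rewrite Hz ?inE ?eqxx ?orbT // eq_sym (negPf npq).
  have := sub (exist _ z z0); rewrite /zero_or /= zp eqxx orbT => /(_ isT).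
  by rewrite /dvdn zq !modn_small // (negPf ts) gtn_eqF.
split=> //; subst q; have := sub (exist _ r r0).
by rewrite /zero_or /= eqxx orbT dvp // !modn_small // => /(_ isT)/eqP.
Qed.

(** The inclusions for [h] and [g] compose to an inclusion between sets H, which must be an
    equality. *)
Lemma homeo_zero_or h g p r : homeo h g -> odd_residue p r ->
  exists q s, odd_residue q s /\ forall x, zero_or p r x = zero_or q s (h x).
Proof.
move=> hg v; have [q [s [vq Hq]]] := homeo_zero_or_sub hg v.
have [p' [r' [v' H']]] := homeo_zero_or_sub (homeo_sym hg) vq.
have [hK _ _ _] := hg.
have [|ep er] := @zero_or_sub_inj p r p' r' v v'; first by move=> x /Hq/H'; rewrite hK.
exists q, s; split=> // x; apply/idP/idP => [/Hq //|/H'].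
by rewrite hK ep er.
Qed.

(* Chinese remaindering: a point avoiding one class modulo each prime that occurs
   would escape the cover. *)
Lemma zero_or_cover p (q s : nat -> nat) :
  (forall r, 0 < r < p -> odd_residue (q r) (s r)) ->
  (forall y, exists2 r, 0 < r < p & zero_or (q r) (s r) y) ->
  exists d, [/\ prime d, 2 < d & forall t, 0 < t < d ->
    exists r, [/\ 0 < r < p, q r = d & s r = t]].
Proof.
move=> v cov; apply: NNPP => nex.
have /functional_choice[t Ht] d : exists t, prime d -> 2 < d ->
    0 < t < d /\ forall r, 0 < r < p -> q r = d -> s r <> t.
  apply: NNPP => nt; apply: nex; exists d; split.
  - by apply/negPn/negP => nd; apply: nt; exists 0 => dd; rewrite dd in nd.
  - by apply/negPn/negP => nd; apply: nt; exists 0 => _ dd; rewrite dd in nd.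
  move=> t td; apply: NNPP => nr; apply: nt; exists t => _ _; split=> // r rp qr sr.
  by apply: nr; exists r.
have [|y y0 Hy] := @crt_primes (map q (iota 1 p.-1)) t.
  apply/allP => d /mapP[r]; rewrite mem_iota => /andP[r0 rp] ->.
  by have [|//] := v r; rewrite r0; lia.
have [r rp Hr] := cov (exist _ y y0); have [pq q2 sq] := v r rp.
have [tq nst] := Ht _ pq q2.
have yt : y = t (q r) %[mod q r].
  by apply: Hy; apply: map_f; rewrite mem_iota; lia.
case/andP: sq tq => [s0 sq] /andP[t0 tq].
move: Hr; rewrite /zero_or /dvdn /= yt !modn_small // gtn_eqF //= => /eqP e.
exact: (nst r rp).
Qed.

(** * Invariance of the prime *)

(** The images of the [p - 1] sets H(p,r) cover N, hence include every H(d,t) for some [d]; counting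
    gives [d <= p]. *)
Lemma homeo_zero_or_prime_le h g p : homeo h g -> prime p -> 2 < p ->
  exists d, [/\ prime d, 2 < d, d <= p & forall t, 0 < t < d ->
    exists2 r, 0 < r < p & forall x, zero_or p r x = zero_or d t (h x)].
Proof.
move=> hg pp p2; have [hK gK _ _] := hg.
have /functional_choice[f Hf] r : exists c : nat * nat, 0 < r < p ->
    odd_residue c.1 c.2 /\ forall x, zero_or p r x = zero_or c.1 c.2 (h x).
  case: (boolP (0 < r < p)) => rp; last by exists (0, 0).
  have [|q [s Hq]] := @homeo_zero_or h g p r hg; first by split.
  by exists (q, s).
have [||d [pd d2 Hd]] := @zero_or_cover p (fun r => (f r).1) (fun r => (f r).2).
- by move=> r /Hf[].
- move=> y; have [gy|ngy] := boolP (p %| sval (g y)).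
    exists 1; first by rewrite /= ltnW.
    have [|_ E] := Hf 1; first by rewrite /= ltnW.
    by rewrite -(gK y) -E /zero_or gy.
  have rp : 0 < sval (g y) %% p < p by rewrite lt0n ngy ltn_pmod // prime_gt0.
  exists (sval (g y) %% p) => //; have [_ E] := Hf _ rp.
  by rewrite -{3}(gK y) -E /zero_or modn_mod eqxx orbT.
have {}Hd t : 0 < t < d -> exists2 r, 0 < r < p & forall x, zero_or p r x = zero_or d t (h x).
  by move=> /Hd[r [rp <- <-]]; exists r => //; apply: (proj2 (Hf r rp)).
exists d; split=> //.
have /functional_choice[rho Hrho] t : exists r, 0 < t < d ->
    0 < r < p /\ forall x, zero_or p r x = zero_or d t (h x).
  case: (boolP (0 < t < d)) => td; last by exists 0.
  by have [r ? ?] := Hd t td; exists r.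
have mi n k : (k \in iota 1 n.-1) = (0 < k < n).
  by rewrite mem_iota; case: n => [|n] //=; lia.
have : size (map rho (iota 1 d.-1)) <= size (iota 1 p.-1).
  apply: uniq_leq_size => [|r /mapP[t]]; last by rewrite !mi => /Hrho[rp _] ->.
  rewrite map_inj_in_uniq ?iota_uniq // => t t'; rewrite !mi => td td' e.
  have [_ E] := Hrho t td; have [_ E'] := Hrho t' td'.
  have [|||_] // := @zero_or_sub_inj d t d t' => z.
  by rewrite -(gK z) -E -E' e.
by rewrite size_map !size_iota; move: (prime_gt0 pp) (prime_gt0 pd); lia.
Qed.

(** Going by [g] and back by [h] yields primes [e <= d <= p] with H(e,1) equal to some H(p,u),
    whence [e = d = p]. *)
Lemma homeo_zero_or_prime h g p r : homeo h g -> prime p -> 2 < p -> 0 < r < p ->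
  exists2 s, 0 < s < p & forall x, zero_or p r x = zero_or p s (h x).
Proof.
move=> hg pp p2 rp; have hg' := homeo_sym hg; have [hK gK _ _] := hg.
have [d [pd d2 dp Hd]] := homeo_zero_or_prime_le hg' pp p2.
have [e [pe e2 ed He]] := homeo_zero_or_prime_le hg pd d2.
have ep : e = p.
  have [|t td Et] := He 1; first by rewrite /= ltnW.
  have [u up Eu] := Hd t td.
  have v1 : odd_residue e 1 by split=> //=; exact: ltnW.
  have vu : odd_residue p u by [].
  have [|//] := zero_or_sub_inj v1 vu.
  by move=> x; rewrite Eu Et gK.
have edp : d = p by apply/eqP; rewrite eqn_leq dp -{1}ep ed.
subst d; have [s sp Es] := Hd r rp.
by exists s => // x; rewrite Es hK.
Qed.

(** * Congruences to powers of 2 and rigidity *)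

(** The fixed point [2 ^ n], prime to [p], identifies the residue of the image set. *)
Lemma homeo_zero_or_pow2 h g p n x : homeo h g -> prime p -> 2 < p ->
  zero_or p (2 ^ n) (h x) = zero_or p (2 ^ n) x.
Proof.
move=> hg pp p2; have n2 := odd_prime_ndvd_pow2 n pp p2.
have [|s sp Es] := @homeo_zero_or_prime h g p (2 ^ n %% p) hg pp p2.
  by rewrite lt0n n2 ltn_pmod // prime_gt0.
have := Es (pow2 n); rewrite (homeo_pow2 n hg) /zero_or /= (negPf n2) modn_mod eqxx /=.
by move=> /esym/eqP es; have := Es x; rewrite /zero_or !modn_mod -es => ->.
Qed.

(** If [p] divided [h x], then [x] would lie in both H(p,1) and H(p,2), hence be divisible by
    [p]. *)
Lemma homeo_cong_pow2 h g p n x : homeo h g -> prime p -> 2 < p ->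
  sval x = 2 ^ n %[mod p] -> sval (h x) = 2 ^ n %[mod p].
Proof.
move=> hg pp p2 xn.
have npx : ~~ (p %| sval x) by rewrite /dvdn xn; apply: odd_prime_ndvd_pow2.
have := homeo_zero_or_pow2 n x hg pp p2; rewrite {2}/zero_or xn eqxx orbT => /orP[pd|/eqP //].
have := homeo_zero_or_pow2 0 x hg pp p2; have := homeo_zero_or_pow2 1 x hg pp p2.
rewrite /zero_or pd (negPf npx) /= expn0 expn1 => /esym/eqP-> /esym.
by rewrite (modn_small p2) (modn_small (ltnW p2)).
Qed.

(* With [x = 2^a m] and [N = 2^m - m], Euler's theorem modulo [N D] makes
   [2^n - m] congruent to [N] modulo [N D] for infinitely many [n], so that
   [(2^n - m) / N] is coprime to [D]. *)
Lemma pow2_cong_prime x D : 0 < x -> odd D ->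
  exists p n, [/\ prime p, 2 < p, x = 2 ^ n %[mod p] & ~~ (p %| D)].
Proof.
move=> x0 oD; have [m cm xm] := @pfactor_coprime 2 x isT x0.
set a := logn 2 x in xm; have om : odd m by rewrite -coprime2n.
have m0 : 0 < m by case: (m) om.
have mlt : m < 2 ^ m by apply: ltn_expl.
pose N := 2 ^ m - m.
have N0 : 0 < N by rewrite /N subn_gt0.
have oN : odd N by rewrite /N oddB ?om ?oddX 1?ltnW //; case: (m) m0.
have D0 : 0 < D by case: (D) oD.
pose phi := totient (N * D).
have phi0 : 0 < phi by rewrite totient_gt0 muln_gt0 N0.
have := @Euler_exp_totient 2 (N * D); rewrite coprime2n oddM oN oD => /(_ isT) /eqP.
rewrite -/phi eqn_mod_dvd ?expn_gt0 // => /dvdnP[t Et].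
have lt1 : 2 ^ 1 <= 2 ^ phi by rewrite leq_exp2l.
have t0 : 0 < t by case: (t) Et => //; rewrite mul0n; lia.
(* This is the quotient of [2 ^ (m + phi) - m] by [N]; it is odd since [m] is positive. *)
pose w := 1 + 2 ^ m * D * t.
have [|p pp pw] := @pdivP w; first by rewrite /w add1n ltnS !muln_gt0 expn_gt0 D0 t0.
have eN : 2 ^ (m + phi) = m + N * w.
  have -> : 2 ^ (m + phi) = 2 ^ m + 2 ^ m * (t * (N * D)).
    rewrite expnD -Et mulnBr muln1 subnKC //.
    by rewrite leq_pmulr // expn_gt0.
  have -> : 2 ^ m = m + N by rewrite /N subnKC // ltnW.
  rewrite /w; have -> : 2 ^ m = m + N by rewrite /N subnKC // ltnW.
  nia.
exists p, (a + (m + phi)); split=> //.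
- have := prime_gt1 pp; rewrite leq_eqVlt => /orP[/eqP e|//].
  by move: pw; rewrite -e dvdn2 /w oddD !oddM oddX; case: (m) m0.
- rewrite xm expnD mulnC; apply/eqP; rewrite eq_sym eqn_mod_dvd.
    by rewrite -mulnBr eN addKn !dvdn_mull.
  by rewrite leq_mul2l eN leq_addr orbT.
- apply/negP => pD; move: pw; rewrite /w addnC dvdn_addr ?dvdn1.
    by move=> /eqP p1; rewrite p1 in pp.
  by rewrite dvdn_mulr // dvdn_mull.
Qed.

Theorem theorem0p1 : forall h : posnat -> posnat, kirch_homeomorphism h -> forall x : posnat, h x = x.
Proof.
move=> h [g [hK [gK [ch cg]]]] x; have hg : homeo h g by [].
apply: val_inj; apply: NNPP => nhx.
(* Subtraction truncates at 0, so the sum is the absolute difference. *)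
pose d := (sval (h x) - sval x) + (sval x - sval (h x)).
have d0 : 0 < d by rewrite /d; move: nhx => /=; lia.
(* An odd prime not dividing the odd part [D] of [d] cannot divide [d]. *)
have [D cD dD] := @pfactor_coprime 2 d isT d0.
have [|p [n [pp p2 xn npD]]] := @pow2_cong_prime (sval x) D (svalP x).
  by rewrite -coprime2n.
have hn := homeo_cong_pow2 hg pp p2 xn.
have : p %| d.
  have hx : sval (h x) == sval x %[mod p] by rewrite hn xn.
  rewrite /d; case: (leqP (sval x) (sval (h x))) => le.
    by rewrite (eqP (_ : sval x - sval (h x) == 0)) ?subn_eq0 // addn0 -eqn_mod_dvd.
  by rewrite (eqP (_ : sval (h x) - sval x == 0)) ?subn_eq0 1?ltnW // -eqn_mod_dvd
    1?eq_sym // ltnW.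
by rewrite dD Euclid_dvdM // (negPf npD) (negPf (odd_prime_ndvd_pow2 _ pp p2)).
Qed.
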